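(* Let $\mathcal{G}$ be a minor-closed class of graphs, i.e. if $G\in\mathcal{G}$ and $H$ is a minor of $G$ then $H\in\mathcal{G}$. Let $G\in\mathcal{G}$ be a $k$-chromatic graph and let $e=\{x,y\}$ be a drawn implicit-edge of $G$ (that is, $e\in E(G)$ and $e$ is an implicit-edge of $G$). Then the graph $G/e$ obtained by contracting $e$ is a $(k+1)$-chromatic graph in $\mathcal{G}$. Moreover, in general, for any $k$-chromatic graph $G$ and any implicit-edge $e=\{x,y\}$ of $G$ (drawn or not), the graph $G/e$ is $(k+1)$-chromatic.
   Context: All graphs are simple (undirected, no loops, no multiple edges). A $k$-coloring of a graph is a proper vertex coloring using a set of $k$ colors (adjacent vertices get distinct colors; not all colors need be used). A graph is $k$-chromatic if its chromatic number equals $k$. For distinct vertices $i,j$ of $G$, $G-ij$ denotes $G$ with the edge $\{i,j\}$ deleted if it is present (and $G-ij=G$ if $\{i,j\}\notin E(G)$). For a $k$-chromatic graph $G$, a 2-subset $\{i,j\}$ of $V(G)$ is an implicit-edge of $G$ if there is no $k$-coloring of $G-ij$ in which $i$ and $j$ receive the same color. An implicit-edge $\{i,j\}$ is called drawn if $\{i,j\}\in E(G)$ and non-drawn otherwise. For $e=\{x,y\}$, $G/e$ denotes the simple graph obtained by merging $x$ and $y$ into a single vertex adjacent to every other vertex that was adjacent to $x$ or $y$ (edge contraction if $e\in E(G)$, vertex identification if $e\notin E(G)$). *)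

(* Defs.v *)
From mathcomp Require Import all_boot.
From Stdlib Require Import Relation_Operators.

Set Implicit Arguments.
Unset Strict Implicit.
Unset Printing Implicit Defensive.

(* Simple graphs; the vertex set is not assumed to be finite. *)
Record graph := Graph {
  vertex :> Type;
  adj : vertex -> vertex -> Prop;
  adj_sym : forall u v, adj u v -> adj v u;
  adj_irrefl : forall v, ~ adj v v }.

Definition proper_coloring (G : graph) (k : nat) (c : G -> 'I_k) : Prop :=
  forall u v : G, adj u v -> c u <> c v.

Definition colorable (G : graph) (k : nat) : Prop :=
  exists c : G -> 'I_k, proper_coloring c.

Definition chromatic (G : graph) (k : nat) : Prop :=
  colorable G k /\ forall m : nat, colorable G m -> k <= m.

Section EdgeDeletion.
Variables (G : graph) (i j : G).

Definition del_edge_adj (u v : G) : Prop :=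
  adj u v /\ ~ (u = i /\ v = j \/ u = j /\ v = i).

Lemma del_edge_sym u v : del_edge_adj u v -> del_edge_adj v u.
Proof. by case=> /adj_sym uv nij; split=> //; tauto. Qed.

Lemma del_edge_irrefl v : ~ del_edge_adj v v.
Proof. by case=> /adj_irrefl. Qed.

Definition del_edge : graph := Graph del_edge_sym del_edge_irrefl.

End EdgeDeletion.

(* [k] is meant to be the chromatic number of [G]. *)
Definition implicit_edge (G : graph) (k : nat) (i j : G) : Prop :=
  i <> j /\
  ~ exists c : del_edge i j -> 'I_k, proper_coloring c /\ c i = c j.

Definition drawn_implicit_edge (G : graph) (k : nat) (i j : G) : Prop :=
  implicit_edge k i j /\ adj i j.

Section Contraction.
Variables (G : graph) (x y : G).

(* [None] is the vertex resulting from merging [x] and [y], which need not be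
   adjacent. *)
Definition contract_vertex : Type := option {v : G | v <> x /\ v <> y}.

Definition contract_adj (a b : contract_vertex) : Prop :=
  match a, b with
  | Some u, Some v => adj (sval u) (sval v)
  | None, Some v => adj x (sval v) \/ adj y (sval v)
  | Some u, None => adj x (sval u) \/ adj y (sval u)
  | None, None => False
  end.

Lemma contract_sym a b : contract_adj a b -> contract_adj b a.
Proof. by case: a b => [u|] [v|] //=; apply: adj_sym. Qed.

Lemma contract_irrefl a : ~ contract_adj a a.
Proof. by case: a => [u|] //=; apply: adj_irrefl. Qed.

Definition contract : graph := Graph contract_sym contract_irrefl.

End Contraction.

(* Nonempty, and connected in the subgraph of [G] induced by [B]. *)
Definition connected_set (G : graph) (B : G -> Prop) : Prop :=
  (exists v, B v) /\
  forall u v : G, B u -> B v ->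
    clos_refl_trans G (fun a b => [/\ B a, B b & adj a b]) u v.

(* [H] is a minor of [G]: [B h] is the branch set of the vertex [h], i.e. the
   set of vertices of [G] contracted to [h]. In particular, minors are taken
   up to isomorphism. *)
Definition minor (H G : graph) : Prop :=
  exists B : H -> G -> Prop,
    [/\ forall h, connected_set (B h),
        forall h h' v, B h v -> B h' v -> h = h' &
        forall h h', adj h h' -> exists u v, [/\ B h u, B h' v & adj u v]].

Definition minor_closed (C : graph -> Prop) : Prop :=
  forall G H : graph, C G -> minor H G -> C H.

(* Main.v *)
Require Import Defs.
From mathcomp Require Import all_boot.
From Stdlib Require Import Relation_Operators ClassicalEpsilon ProofIrrelevance.

(** A coloring of [G/e] is the same thing as a coloring of [G - e] that is
    constant on [e]; hence an implicit-edge rules out [k] colors for [G/e]. One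
    extra color, given to the merged vertex only, is always enough. *)

Set Implicit Arguments.
Unset Strict Implicit.
Unset Printing Implicit Defensive.

Lemma colorable_leq (G : graph) (m n : nat) :
  m <= n -> colorable G m -> colorable G n.
Proof.
move=> le_mn [c c_proper]; exists (fun v => widen_ord le_mn (c v)) => u v uv.
by move/(congr1 val) => /= /val_inj; apply: c_proper.
Qed.

Section ContractionMap.
Variables (G : graph) (x y : G).

(** The quotient map from [G] onto [G/e]. Equality on vertices need not be decidable, so the case
    split is classical; it is informative because a vertex of [G/e] carries the proof that it avoids
    [x] and [y]. *)
Definition contract_map (v : G) : contract x y :=
  match excluded_middle_informative (v <> x /\ v <> y) with
  | left v_xy => Some (exist _ v v_xy)
  | right _ => None
  end.

Variant contract_map_spec (v : G) : contract x y -> Prop :=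
  | ContractMapMerged of v = x \/ v = y : contract_map_spec v None
  | ContractMapOther v_xy : contract_map_spec v (Some (exist _ v v_xy)).

Lemma contract_mapP v : contract_map_spec v (contract_map v).
Proof.
rewrite /contract_map; case: excluded_middle_informative => [v_xy|v_xy].
  exact: ContractMapOther.
apply: ContractMapMerged; case: (classic (v = x)) => [|vx]; first by left.
by case: (classic (v = y)) => [|vy]; [right | case: v_xy].
Qed.

Lemma contract_mapl : contract_map x = None.
Proof. by case: contract_mapP => // - []. Qed.

Lemma contract_mapr : contract_map y = None.
Proof. by case: contract_mapP => // - []. Qed.

Lemma contract_map_sval (u : {v : G | v <> x /\ v <> y}) :
  contract_map (sval u) = Some u.
Proof.
case: u => v v_xy /=; case: contract_mapP => [|v_xy'].
  by case: v_xy => vx vy [].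
(* The two vertices differ at most in the proof component. *)
by rewrite (proof_irrelevance _ v_xy v_xy').
Qed.

(** Deleting the edge [xy], if present, is what makes the quotient map a graph homomorphism: that
    edge alone would become a loop at the merged vertex. *)
Lemma contract_map_adj (u v : del_edge x y) :
  adj u v -> adj (contract_map u) (contract_map v).
Proof.
case=> uv not_xy.
case: (contract_mapP u) => [u_xy|u_xy]; case: (contract_mapP v) => [v_xy|v_xy] //=.
- case: u_xy v_xy uv not_xy => -> [] -> uv not_xy.
  + exact: adj_irrefl uv.
  + by apply: not_xy; left.
  + by apply: not_xy; right.
  + exact: adj_irrefl uv.
- by case: u_xy uv => -> ; [left | right].
- by case: v_xy uv => -> /adj_sym; [left | right].
Qed.

Lemma contract_colorable_succ k : colorable G k -> colorable (contract x y) k.+1.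
Proof.
case=> c c_proper.
(* [lift ord_max] embeds the [k] old colors into those other than [ord_max], which is thus free for
   the merged vertex. *)
exists (fun a : contract x y =>
  if a is Some u then lift ord_max (c (sval u)) else ord_max).
case=> [u|] [v|] //= uv.
- by move/lift_inj; apply: c_proper.
- by move/esym/eqP; apply/negP/neq_lift.
- by move/eqP; apply/negP/neq_lift.
Qed.

Lemma implicit_edge_contract k :
  implicit_edge k x y -> ~ colorable (contract x y) k.
Proof.
case=> _ no_coloring [c c_proper]; apply: no_coloring.
exists (c \o contract_map); split=> [u v uv|].
  exact/c_proper/contract_map_adj.
by rewrite /= contract_mapl contract_mapr.
Qed.

Lemma contract_chromatic k :
  colorable G k -> implicit_edge k x y -> chromatic (contract x y) k.+1.
Proof.
move=> Gk e_impl; split; first exact: contract_colorable_succ.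
move=> m col_m; rewrite ltnNge; apply/negP => le_mk.
exact: (implicit_edge_contract e_impl) (colorable_leq le_mk col_m).
Qed.

(** The branch sets are the fibers of [contract_map]: singletons, except for the fiber of [None],
    which is the pair of [x] and [y] and is connected by the edge [xy]. *)
Lemma contract_minor : adj x y -> minor (contract x y) G.
Proof.
move=> xy; exists (fun h v => contract_map v = h); split.
- move=> h; split.
    case: h => [u|]; first by exists (sval u); exact: contract_map_sval.
    by exists x; exact: contract_mapl.
  move=> u v uh vh.
  (* Within a fiber, a path of length at most one suffices. *)
  have [<-|adj_uv] : u = v \/ adj u v; [|exact: rt_refl|exact: rt_step].
  move: vh; rewrite -uh.
  case: (contract_mapP u) => [u_xy|u_xy]; case: (contract_mapP v) => [v_xy|v_xy] //.
    by case: u_xy v_xy => -> [] -> _; auto; right; exact: adj_sym.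
  by case=> ->; left.
- by move=> h h' v <-.
(* An edge of [G/e] at the merged vertex lifts to an edge of [G] at [x] or at [y], both of which lie
   in the branch set of [None]. *)
- have from_merged (v : {v : G | v <> x /\ v <> y}) :
      adj x (sval v) \/ adj y (sval v) ->
      exists2 w, contract_map w = None & adj w (sval v).
    by case=> ?; [exists x | exists y]; rewrite ?contract_mapl ?contract_mapr.
  case=> [u|] [v|] //= uv.
  + by exists (sval u), (sval v); rewrite !contract_map_sval.
  + have [w wN wu] := from_merged _ uv.
    by exists (sval u), w; rewrite contract_map_sval; split=> //; exact: adj_sym.
  + have [w wN wv] := from_merged _ uv.
    by exists w, (sval v); rewrite contract_map_sval.
Qed.

End ContractionMap.

Theorem corollary3p13 :
  (forall (C : graph -> Prop), minor_closed C ->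
   forall (G : graph) (k : nat) (x y : G),
     C G -> chromatic G k -> drawn_implicit_edge k x y ->
     chromatic (contract x y) k.+1 /\ C (contract x y)) /\
  (forall (G : graph) (k : nat) (x y : G),
     chromatic G k -> implicit_edge k x y ->
     chromatic (contract x y) k.+1).
Proof.
split=> [C C_closed G k x y CG [Gk _] [e_impl xy] | G k x y [Gk _] e_impl].
  split; first exact: contract_chromatic.
  exact: C_closed CG (contract_minor xy).
exact: contract_chromatic.
Qed.
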